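(* Let $H=\{H_\alpha\}_{\alpha\in\pi}$ be a Hopf $\pi$-coalgebra. The following conditions are equivalent: (a) every reduced right $\pi$-comodule over $H$ is cosemisimple; (b) $H$ is cosemisimple; (c) there exists a right $\pi$-integral $\lambda=(\lambda_\alpha)_{\alpha\in\pi}$ for $H$ such that $\lambda_\alpha(1_\alpha)=1$ for some $\alpha\in\pi$; (d) there exists a right $\pi$-integral $\lambda=(\lambda_\alpha)_{\alpha\in\pi}$ for $H$ such that $\lambda_\alpha(1_\alpha)=1$ for all $\alpha\in\pi$ with $H_\alpha\neq0$.
   Context: Throughout, $\pi$ is a discrete group with neutral element $1$, $\Bbbk$ is a field, $\otimes=\otimes_\Bbbk$, and algebras are associative and unital over $\Bbbk$ (the zero algebra is allowed). A $\pi$-coalgebra is a family $C=\{C_\alpha\}_{\alpha\in\pi}$ of $\Bbbk$-spaces with $\Bbbk$-linear maps $\Delta_{\alpha,\beta}:C_{\alpha\beta}\to C_\alpha\otimes C_\beta$ and $\epsilon:C_1\to\Bbbk$ such that $(\Delta_{\alpha,\beta}\otimes\mathrm{id}_{C_\gamma})\Delta_{\alpha\beta,\gamma}=(\mathrm{id}_{C_\alpha}\otimes\Delta_{\beta,\gamma})\Delta_{\alpha,\beta\gamma}$ and $(\mathrm{id}_{C_\alpha}\otimes\epsilon)\Delta_{\alpha,1}=\mathrm{id}_{C_\alpha}=(\epsilon\otimes\mathrm{id}_{C_\alpha})\Delta_{1,\alpha}$ for all $\alpha,\beta,\gamma\in\pi$. A Hopf $\pi$-coalgebra is a $\pi$-coalgebra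 $H=(\{H_\alpha\},\Delta,\epsilon)$ with $\Bbbk$-linear maps $S_\alpha:H_\alpha\to H_{\alpha^{-1}}$ such that each $H_\alpha$ is an algebra with multiplication $m_\alpha$ and unit $1_\alpha$, the maps $\epsilon$ and all $\Delta_{\alpha,\beta}$ are algebra homomorphisms, and $m_\alpha(S_{\alpha^{-1}}\otimes\mathrm{id}_{H_\alpha})\Delta_{\alpha^{-1},\alpha}=\epsilon 1_\alpha=m_\alpha(\mathrm{id}_{H_\alpha}\otimes S_{\alpha^{-1}})\Delta_{\alpha,\alpha^{-1}}$ for all $\alpha$. A right $\pi$-integral for $H$ is a family $\lambda=(\lambda_\alpha)_{\alpha\in\pi}\in\prod_{\alpha}H_\alpha^*$ with $(\lambda_\alpha\otimes\mathrm{id}_{H_\beta})\Delta_{\alpha,\beta}=\lambda_{\alpha\beta}\,1_\beta$ for all $\alpha,\beta\in\pi$. A right $\pi$-comodule over a $\pi$-coalgebra $C$ is a family $M=\{M_\alpha\}_{\alpha\in\pi}$ of $\Bbbk$-spaces with linear maps $\rho_{\alpha,\beta}:M_{\alpha\beta}\to M_\alpha\otimes C_\beta$ such that $(\rho_{\alpha,\beta}\otimes\mathrm{id}_{C_\gamma})\rho_{\alpha\beta,\gamma}=(\mathrm{id}_{M_\alpha}\otimes\Delta_{\beta,\gamma})\rho_{\alpha,\beta\gamma}$ and $(\mathrm{id}_{M_\alpha}\otimes\epsilon)\rho_{\alpha,1}=\mathrm{id}_{M_\alpha}$. A $\pi$-subcomodule of $M$ is a family of subspaces $N_\alpha\subset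 M_\alpha$ with $\rho_{\alpha,\beta}(N_{\alpha\beta})\subset N_\alpha\otimes C_\beta$. Sums and direct sums of $\pi$-subcomodules are taken componentwise. $M$ is simple if $M_\alpha\ne0$ for some $\alpha$ and its only $\pi$-subcomodules are $0=\{0\}_{\alpha}$ and $M$. $M$ is cosemisimple if it satisfies the following equivalent conditions: it is a sum of simple $\pi$-subcomodules; it is a direct sum of simple $\pi$-subcomodules; every $\pi$-subcomodule of $M$ is a direct summand (has a complementary $\pi$-subcomodule). A $\pi$-coalgebra (in particular a Hopf $\pi$-coalgebra) is cosemisimple if it is cosemisimple as a right $\pi$-comodule over itself with structure maps the $\Delta_{\alpha,\beta}$. A right $\pi$-comodule $M$ over $H$ is reduced if $M_\alpha=0$ whenever $H_\alpha=0$. *)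

(* Defs.v *)
From HB Require Import structures.
From mathcomp Require Import all_boot all_order all_algebra.
From mathcomp Require Import generic_quotient sesquilinear.
From mathcomp Require Import boolp classical_sets.

Set Implicit Arguments.
Unset Strict Implicit.
Unset Printing Implicit Defensive.

Import GRing.Theory.
Local Open Scope ring_scope.
Local Open Scope quotient_scope.
Local Open Scope classical_set_scope.

(* ------------------------------------------------------------------------ *)
(* The tensor product V (x) W of two vector spaces of arbitrary dimension.   *)
(* A finite list [:: (v1, w1); ..; (vn, wn)] stands for the formal sum       *)
(* v1 (x) w1 + .. + vn (x) wn, and two lists are identified when no bilinear *)
(* map out of V x W tells them apart; tlift, tlift_tens and tlift_unique are *)
(* the universal property.                                                   *)
(* ------------------------------------------------------------------------ *)

Section Tensor.
Variables (k : fieldType) (V W : lmodType k).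

Definition tensor_eval (U : lmodType k) (f : V -> W -> U) (s : seq (V * W)) : U :=
  \sum_(p <- s) f p.1 p.2.

Definition tensor_equiv (s t : seq (V * W)) : bool :=
  `[< forall (U : lmodType k) (f : {bilinear V -> W -> U}),
        tensor_eval f s = tensor_eval f t >].

Lemma tensor_equiv_refl : reflexive tensor_equiv.
Proof. by move=> s; apply/asboolP. Qed.

Lemma tensor_equiv_sym : symmetric tensor_equiv.
Proof. by move=> s t; apply/asboolP/asboolP => h U f; rewrite h. Qed.

Lemma tensor_equiv_trans : transitive tensor_equiv.
Proof.
move=> t s u /asboolP st /asboolP tu; apply/asboolP => U f.
by rewrite st tu.
Qed.

Canonical tensor_equiv_equiv :=
  EquivRel tensor_equiv tensor_equiv_refl tensor_equiv_sym tensor_equiv_trans.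

Definition tensor := {eq_quot tensor_equiv}.

HB.instance Definition _ := Choice.on tensor.
HB.instance Definition _ := EqQuotient.on tensor.

Implicit Types x y z : tensor.

Lemma tensor_piP s t :
  (forall (U : lmodType k) (f : {bilinear V -> W -> U}),
     tensor_eval f s = tensor_eval f t) <-> \pi_tensor s = \pi_tensor t.
Proof.
split=> [h|/eqmodP/asboolP //].
by apply/eqmodP/asboolP.
Qed.

Lemma tensor_eval_repr (U : lmodType k) (f : {bilinear V -> W -> U}) s :
  tensor_eval f (repr (\pi_tensor s)) = tensor_eval f s.
Proof. by move: U f; apply/tensor_piP; rewrite reprK. Qed.

Lemma tensor_eqP x y :
  (forall (U : lmodType k) (f : {bilinear V -> W -> U}),
     tensor_eval f (repr x) = tensor_eval f (repr y)) -> x = y.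
Proof. by move/tensor_piP; rewrite !reprK. Qed.

Definition tensor_zero : tensor := \pi_tensor [::].
Definition tensor_add x y : tensor := \pi_tensor (repr x ++ repr y).
Definition tensor_scale (c : k) x : tensor :=
  \pi_tensor [seq (c *: p.1, p.2) | p <- repr x].
Definition tensor_opp x : tensor := tensor_scale (- 1) x.

Section Eval.
Variables (U : lmodType k) (f : {bilinear V -> W -> U}).

Lemma tensor_eval0 : tensor_eval f (repr tensor_zero) = 0.
Proof. by rewrite tensor_eval_repr /tensor_eval big_nil. Qed.

Lemma tensor_evalD x y : tensor_eval f (repr (tensor_add x y)) =
  tensor_eval f (repr x) + tensor_eval f (repr y).
Proof. by rewrite tensor_eval_repr /tensor_eval big_cat. Qed.

Lemma tensor_evalZ c x :
  tensor_eval f (repr (tensor_scale c x)) = c *: tensor_eval f (repr x).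
Proof.
rewrite tensor_eval_repr /tensor_eval big_map scaler_sumr.
by apply: eq_bigr => p _; rewrite linearZl_LR.
Qed.
End Eval.

Let evalE := (tensor_eval0, tensor_evalD, tensor_evalZ).

Lemma tensor_addA : associative tensor_add.
Proof. by move=> x y z; apply: tensor_eqP => U f; rewrite !evalE addrA. Qed.
Lemma tensor_addC : commutative tensor_add.
Proof. by move=> x y; apply: tensor_eqP => U f; rewrite !evalE addrC. Qed.
Lemma tensor_add0 : left_id tensor_zero tensor_add.
Proof. by move=> x; apply: tensor_eqP => U f; rewrite !evalE add0r. Qed.
Lemma tensor_addN : left_inverse tensor_zero tensor_opp tensor_add.
Proof.
by move=> x; apply: tensor_eqP => U f; rewrite !evalE scaleN1r addNr.
Qed.

HB.instance Definition _ := GRing.isZmodule.Build tensor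
  tensor_addA tensor_addC tensor_add0 tensor_addN.

Lemma tensor_scaleA a b x :
  tensor_scale a (tensor_scale b x) = tensor_scale (a * b) x.
Proof. by apply: tensor_eqP => U f; rewrite !evalE scalerA. Qed.
Lemma tensor_scale1 : left_id 1 tensor_scale.
Proof. by move=> x; apply: tensor_eqP => U f; rewrite !evalE scale1r. Qed.
Lemma tensor_scaleDr : right_distributive tensor_scale +%R.
Proof.
by move=> a x y; apply: tensor_eqP => U f; rewrite !evalE scalerDr.
Qed.
Lemma tensor_scaleDl x : {morph tensor_scale^~ x : a b / a + b}.
Proof.
by move=> a b; apply: tensor_eqP => U f; rewrite !evalE scalerDl.
Qed.

HB.instance Definition _ := GRing.Zmodule_isLmodule.Build k tensor
  tensor_scaleA tensor_scale1 tensor_scaleDr tensor_scaleDl.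

Definition tens (v : V) (w : W) : tensor := \pi_tensor [:: (v, w)].

Lemma tens_eval (U : lmodType k) (f : {bilinear V -> W -> U}) v w :
  tensor_eval f (repr (tens v w)) = f v w.
Proof. by rewrite tensor_eval_repr /tensor_eval big_seq1. Qed.

Lemma tens_is_bilinear : bilinear_for *:%R *:%R tens.
Proof.
by split=> u a x y; apply: tensor_eqP => U f;
   rewrite !evalE !tens_eval ?linearPr ?linearPl.
Qed.

HB.instance Definition _ :=
  bilinear_isBilinear.Build k V W tensor _ _ tens tens_is_bilinear.

Lemma tensPl a v v' w : tens (a *: v + v') w = a *: tens v w + tens v' w.
Proof. exact: tens_is_bilinear.1. Qed.
Lemma tensPr a v w w' : tens v (a *: w + w') = a *: tens v w + tens v w'.
Proof. exact: tens_is_bilinear.2. Qed.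

Lemma tensor_pi_sum s : \pi_tensor s = \sum_(p <- s) tens p.1 p.2.
Proof.
elim: s => [|[v w] s IHs]; first by rewrite big_nil.
rewrite big_cons -IHs; apply: tensor_eqP => U f /=.
by rewrite tensor_evalD tens_eval !tensor_eval_repr /tensor_eval big_cons.
Qed.

Lemma tensor_sum x : x = \sum_(p <- repr x) tens p.1 p.2.
Proof. by rewrite -tensor_pi_sum reprK. Qed.

Section Lift.
Variables (U : lmodType k) (f : {bilinear V -> W -> U}).

Definition tlift x : U := tensor_eval f (repr x).

Lemma tlift_is_linear : linear tlift.
Proof. by move=> a x y; rewrite /tlift !evalE. Qed.

HB.instance Definition _ :=
  GRing.isLinear.Build k tensor U _ tlift tlift_is_linear.

Lemma tlift_tens v w : tlift (tens v w) = f v w.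
Proof. exact: tens_eval. Qed.
End Lift.

Lemma tensor_ext (U : lmodType k) (f g : {linear tensor -> U}) :
  (forall v w, f (tens v w) = g (tens v w)) -> f =1 g.
Proof.
move=> h x; rewrite [x]tensor_sum !linear_sum.
by apply: eq_bigr => p _; rewrite h.
Qed.

Lemma tlift_unique (U : lmodType k) (f : {bilinear V -> W -> U})
    (g : {linear tensor -> U}) :
  (forall v w, g (tens v w) = f v w) -> g =1 tlift f.
Proof. by move=> h; apply: tensor_ext => v w; rewrite h /= tlift_tens. Qed.

(* The image of X (x) W in V (x) W, for a subspace X of V. *)
Definition tensor_subl (X : set V) : set tensor :=
  [set x | exists2 s : seq (V * W),
     {in s, forall p, X p.1} & x = \sum_(p <- s) tens p.1 p.2].

End Tensor.

(* tensor V W as an lmodType (the instance declared above). *)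
Notation "V ⊗ W" := (Defs_tensor__canonical__GRing_Lmodule V W)
  (at level 40, left associativity).

Section TensorMap.
Variables (k : fieldType) (V V' W W' : lmodType k).
Variables (f : {linear V -> V'}) (g : {linear W -> W'}).

Definition tmap_pure (v : V) (w : W) : V' ⊗ W' := tens (f v) (g w).

Lemma tmap_pure_is_bilinear : bilinear_for *:%R *:%R tmap_pure.
Proof.
by split=> u a x y; rewrite /tmap_pure linearP ?tensPl ?tensPr.
Qed.

HB.instance Definition _ := bilinear_isBilinear.Build k V W (V' ⊗ W') _ _
  tmap_pure tmap_pure_is_bilinear.

Definition tmap : V ⊗ W -> V' ⊗ W' := tlift tmap_pure.

HB.instance Definition _ := GRing.Linear.on tmap.

Lemma tmap_tens v w : tmap (tens v w) = tens (f v) (g w).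
Proof. exact: tlift_tens. Qed.
End TensorMap.

Section Associator.
Variables (k : fieldType) (U V W : lmodType k).

Definition tassoc_pure2 (w : W) (u : U) (v : V) : U ⊗ (V ⊗ W) :=
  tens u (tens v w).

Lemma tassoc_pure2_is_bilinear w : bilinear_for *:%R *:%R
  (tassoc_pure2 w).
Proof.
by split=> u a x y; rewrite /tassoc_pure2 ?(tensPl, tensPr).
Qed.

HB.instance Definition _ w := bilinear_isBilinear.Build k U V (U ⊗ (V ⊗ W)) _ _
  (tassoc_pure2 w) (tassoc_pure2_is_bilinear w).

Definition tassoc_pure (x : U ⊗ V) (w : W) : U ⊗ (V ⊗ W) :=
  tlift (tassoc_pure2 w) x.

Lemma tassoc_pure_is_bilinear : bilinear_for *:%R *:%R
  tassoc_pure.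
Proof.
split=> [w a x y|x a v w]; first by rewrite /tassoc_pure linearP.
rewrite /tassoc_pure [x]tensor_sum !linear_sum /= scaler_sumr -big_split /=.
apply: eq_bigr => p _.
by rewrite !tlift_tens /= /tassoc_pure2 !tensPr.
Qed.

HB.instance Definition _ := bilinear_isBilinear.Build k (U ⊗ V) W
  (U ⊗ (V ⊗ W)) _ _ tassoc_pure tassoc_pure_is_bilinear.

Definition tassoc : (U ⊗ V) ⊗ W -> U ⊗ (V ⊗ W) := tlift tassoc_pure.

HB.instance Definition _ := GRing.Linear.on tassoc.

Lemma tassoc_tens u v w : tassoc (tens (tens u v) w) = tens u (tens v w).
Proof. by rewrite /tassoc tlift_tens /= /tassoc_pure tlift_tens. Qed.
End Associator.

Section Unitors.
Variables (k : fieldType) (V : lmodType k).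

Definition tunitl_pure (c : k^o) (v : V) : V := (c : k) *: v.
Definition tunitr_pure (v : V) (c : k^o) : V := (c : k) *: v.

Lemma tunitl_pure_is_bilinear : bilinear_for *:%R *:%R
  tunitl_pure.
Proof.
split=> u a x y; rewrite /tunitl_pure.
- by rewrite scalerDl /= scalerA.
- by rewrite scalerDr /= !scalerA [_ * a]mulrC.
Qed.

Lemma tunitr_pure_is_bilinear : bilinear_for *:%R *:%R
  tunitr_pure.
Proof.
split=> u a x y; rewrite /tunitr_pure.
- by rewrite scalerDr /= !scalerA [_ * a]mulrC.
- by rewrite scalerDl /= scalerA.
Qed.

HB.instance Definition _ := bilinear_isBilinear.Build k k^o V V _ _
  tunitl_pure tunitl_pure_is_bilinear.
HB.instance Definition _ := bilinear_isBilinear.Build k V k^o V _ _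
  tunitr_pure tunitr_pure_is_bilinear.

Definition tunitl : k^o ⊗ V -> V := tlift tunitl_pure.
Definition tunitr : V ⊗ k^o -> V := tlift tunitr_pure.

HB.instance Definition _ := GRing.Linear.on tunitl.
HB.instance Definition _ := GRing.Linear.on tunitr.

Lemma tunitl_tens (c : k^o) v : tunitl (tens c v) = (c : k) *: v.
Proof. exact: tlift_tens. Qed.
Lemma tunitr_tens (c : k^o) v : tunitr (tens v c) = (c : k) *: v.
Proof. exact: tlift_tens. Qed.
End Unitors.

(* ------------------------------------------------------------------------ *)
(* Associative unital algebras. The library's algType requires 1 != 0; the   *)
(* zero algebra is needed here, whence this variant.                         *)
(* ------------------------------------------------------------------------ *)

Structure algebra (k : fieldType) := Algebra {
  alg_sort :> lmodType k;
  alg_mul : {bilinear alg_sort -> alg_sort -> alg_sort};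
  alg_one : alg_sort;
  alg_mulA : associative alg_mul;
  alg_mul1l : left_id alg_one alg_mul;
  alg_mul1r : right_id alg_one alg_mul
}.

Definition alg_morphism (k : fieldType) (A B : algebra k) (f : A -> B) : Prop :=
  f (alg_one A) = alg_one B /\ {morph f : x y / alg_mul A x y >-> alg_mul B x y}.

Section Algebra.
Variables (k : fieldType) (A B : algebra k).

Definition tmul : A ⊗ A -> A := tlift (alg_mul A).
HB.instance Definition _ := GRing.Linear.on tmul.

Lemma tmul_tens x y : tmul (tens x y) = alg_mul A x y.
Proof. exact: tlift_tens. Qed.

Definition talg_mul_pure (y : A ⊗ B) (a : A) (b : B) : A ⊗ B :=
  tmap (alg_mul A a) (alg_mul B b) y.

Lemma talg_mul_pure_is_bilinear y :
  bilinear_for *:%R *:%R (talg_mul_pure y).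
Proof.
split=> u c v w; rewrite /talg_mul_pure [y]tensor_sum !linear_sum /= scaler_sumr -big_split /=;
  apply: eq_bigr => p _; rewrite !tmap_tens.
- by rewrite /= linearPl tensPl.
- by rewrite /= linearPl tensPr.
Qed.

HB.instance Definition _ y := bilinear_isBilinear.Build k A B (A ⊗ B) _ _
  (talg_mul_pure y) (talg_mul_pure_is_bilinear y).

(* The bilinear extension of (a (x) b) (c (x) d) = ac (x) bd, see talg_mulE. *)
Definition talg_mul (x y : A ⊗ B) : A ⊗ B := tlift (talg_mul_pure y) x.

Lemma talg_mulE a b c d :
  talg_mul (tens a b) (tens c d) = tens (alg_mul A a c) (alg_mul B b d).
Proof. by rewrite /talg_mul tlift_tens /= /talg_mul_pure tmap_tens. Qed.

Lemma talg_mul_is_bilinear : bilinear_for *:%R *:%R talg_mul.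
Proof.
split=> [y a x x'|x a y y']; first by rewrite /talg_mul linearP.
rewrite /talg_mul [x]tensor_sum !linear_sum /= scaler_sumr -big_split /=.
apply: eq_bigr => p _.
by rewrite !tlift_tens /= /talg_mul_pure linearP.
Qed.

HB.instance Definition _ := bilinear_isBilinear.Build k
  (A ⊗ B) (A ⊗ B) (A ⊗ B) _ _ talg_mul talg_mul_is_bilinear.

Lemma talg_mul0l y : talg_mul 0 y = 0. Proof. exact: linear0l. Qed.
Lemma talg_mul0r y : talg_mul y 0 = 0. Proof. exact: linear0r. Qed.
Lemma talg_mulDl : left_distributive talg_mul +%R.
Proof. by move=> x y z; exact: linearDl. Qed.
Lemma talg_mulDr : right_distributive talg_mul +%R.
Proof. by move=> x y z; exact: linearDr. Qed.

Lemma talg_ind (P : A ⊗ B -> Prop) :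
  P 0 -> (forall x y, P x -> P y -> P (x + y)) ->
  (forall a b, P (tens a b)) -> forall x, P x.
Proof. by move=> P0 PD Pt x; rewrite [x]tensor_sum; apply: big_ind. Qed.

Lemma talg_mulA : associative talg_mul.
Proof.
elim/talg_ind=> [y z|x1 x2 IH1 IH2 y z|a b]; first by rewrite !talg_mul0l.
  by rewrite !talg_mulDl IH1 IH2.
elim/talg_ind=> [z|y1 y2 IH1 IH2 z|c d].
- by rewrite talg_mul0l talg_mul0r talg_mul0l.
- by rewrite talg_mulDl !talg_mulDr talg_mulDl IH1 IH2.
elim/talg_ind=> [|z1 z2 IH1 IH2|e f].
- by rewrite !talg_mul0r.
- by rewrite !talg_mulDr IH1 IH2.
- by rewrite !talg_mulE !alg_mulA.
Qed.

Lemma talg_mul1l : left_id (tens (alg_one A) (alg_one B)) talg_mul.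
Proof.
elim/talg_ind=> [|x y IHx IHy|a b]; first by rewrite talg_mul0r.
- by rewrite talg_mulDr IHx IHy.
- by rewrite talg_mulE !alg_mul1l.
Qed.

Lemma talg_mul1r : right_id (tens (alg_one A) (alg_one B)) talg_mul.
Proof.
elim/talg_ind=> [|x y IHx IHy|a b]; first by rewrite talg_mul0l.
- by rewrite talg_mulDl IHx IHy.
- by rewrite talg_mulE !alg_mul1r.
Qed.

Definition tensor_algebra : algebra k :=
  @Algebra k (A ⊗ B) talg_mul _ talg_mulA talg_mul1l talg_mul1r.

End Algebra.

Section GroundAlgebra.
Variable k : fieldType.

Definition ground_mul (x y : k^o) : k^o := (x : k) * (y : k).

Lemma ground_mul_is_bilinear : bilinear_for *:%R *:%R ground_mul.
Proof.
split=> u a x y.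
- by rewrite /ground_mul [LHS]mulrDl; congr (_ + _); exact/esym/mulrA.
- by rewrite /ground_mul [LHS]mulrDr; congr (_ + _); exact: mulrCA.
Qed.

HB.instance Definition _ := bilinear_isBilinear.Build k k^o k^o k^o _ _
  ground_mul ground_mul_is_bilinear.

Definition ground_algebra : algebra k :=
  @Algebra k k^o ground_mul 1 (@mulrA k) (@mul1r k) (@mulr1 k).
End GroundAlgebra.

(* ------------------------------------------------------------------------ *)
(* Group-indexed families. Elements of a family are transported along the    *)
(* group identities that the axioms below use implicitly.                    *)
(* ------------------------------------------------------------------------ *)

Section Transport.
Variables (I : Type) (k : fieldType) (C : I -> lmodType k).

Definition transp a b (e : a = b) (x : C a) : C b := eq_rect a C x b e.

Lemma transp_is_linear a b (e : a = b) : linear (transp e).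
Proof. by case: b / e. Qed.

HB.instance Definition _ a b (e : a = b) :=
  GRing.isLinear.Build k (C a) (C b) _ (transp e) (transp_is_linear e).

Definition transp_linear a b (e : a = b) : {linear C a -> C b} := transp e.
End Transport.

Section PiCoalgebra.
Variables (pi : groupType) (k : fieldType).

Record picoalgebra_struct (C : pi -> lmodType k) := PiCoalgebraStruct {
  pc_comul : forall a b : pi, {linear C (a * b)%g -> C a ⊗ C b};
  pc_counit : {linear C 1%g -> k^o};
  pc_comulA : forall (a b c : pi) (x : C ((a * b) * c)%g),
    tassoc (tmap (pc_comul a b) idfun (pc_comul (a * b)%g c x)) =
    tmap idfun (pc_comul b c)
      (pc_comul a (b * c)%g (transp (esym (mulgA a b c)) x));
  pc_counitr : forall (a : pi) (x : C (a * 1)%g),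
    tunitr (tmap idfun pc_counit (pc_comul a 1%g x)) = transp (mulg1 a) x;
  pc_counitl : forall (a : pi) (x : C (1 * a)%g),
    tunitl (tmap pc_counit idfun (pc_comul 1%g a x)) = transp (mul1g a) x
}.

Structure picoalgebra := PiCoalgebra {
  pc_sort :> pi -> lmodType k;
  pc_struct : picoalgebra_struct pc_sort
}.

Definition comul (C : picoalgebra) a b : {linear C (a * b)%g -> C a ⊗ C b} :=
  pc_comul (pc_struct C) a b.
Definition counit (C : picoalgebra) : {linear C 1%g -> k^o} :=
  pc_counit (pc_struct C).

Definition transp_inv (A : pi -> algebra k) (a : pi) :
    {linear A (a^-1)^-1%g -> A a} :=
  transp_linear (fun b => A b : lmodType k) (invgK a).

Structure hopf_picoalgebra := HopfPiCoalgebra {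
  hopf_sort :> pi -> algebra k;
  hopf_struct : picoalgebra_struct (fun a => hopf_sort a : lmodType k);
  hopf_comul_morph : forall a b,
    @alg_morphism k (hopf_sort (a * b)%g)
      (tensor_algebra (hopf_sort a) (hopf_sort b)) (pc_comul hopf_struct a b);
  hopf_counit_morph :
    @alg_morphism k (hopf_sort 1%g) (ground_algebra k) (pc_counit hopf_struct);
  antipode : forall a : pi, {linear hopf_sort a -> hopf_sort a^-1%g};
  antipodel : forall (a : pi) (x : hopf_sort 1%g),
    tmul (tmap (transp_inv hopf_sort a \o antipode a^-1%g) idfun
      (pc_comul hopf_struct a^-1%g a (transp (esym (mulVg a)) x))) =
    (pc_counit hopf_struct x : k) *: alg_one (hopf_sort a);
  antipoder : forall (a : pi) (x : hopf_sort 1%g),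
    tmul (tmap idfun (transp_inv hopf_sort a \o antipode a^-1%g)
      (pc_comul hopf_struct a a^-1%g (transp (esym (mulgV a)) x))) =
    (pc_counit hopf_struct x : k) *: alg_one (hopf_sort a)
}.

Definition hopf_coalg (H : hopf_picoalgebra) : picoalgebra :=
  PiCoalgebra (hopf_struct H).
Coercion hopf_coalg : hopf_picoalgebra >-> picoalgebra.

Definition right_integral (H : hopf_picoalgebra)
    (lam : forall a : pi, {linear H a -> k^o}) : Prop :=
  forall (a b : pi) (x : H (a * b)%g),
    tunitl (tmap (lam a) idfun (comul H a b x)) =
    (lam (a * b)%g x : k) *: alg_one (H b).

Structure picomodule (C : picoalgebra) := PiComodule {
  cm_sort :> pi -> lmodType k;
  coact : forall a b : pi, {linear cm_sort (a * b)%g -> cm_sort a ⊗ C b};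
  coactA : forall (a b c : pi) (x : cm_sort ((a * b) * c)%g),
    tassoc (tmap (coact a b) idfun (coact (a * b)%g c x)) =
    tmap idfun (comul C b c)
      (coact a (b * c)%g (transp (esym (mulgA a b c)) x));
  coact1 : forall (a : pi) (x : cm_sort (a * 1)%g),
    tunitr (tmap idfun (counit C) (coact a 1%g x)) = transp (mulg1 a) x
}.

Definition regular_comodule (C : picoalgebra) : picomodule C :=
  @PiComodule C (pc_sort C) (comul C)
    (pc_comulA (pc_struct C)) (pc_counitr (pc_struct C)).

Structure subcomodule (C : picoalgebra) (M : picomodule C) := SubComodule {
  sub_sort :> forall a : pi, set (M a);
  sub_submod : forall a : pi, submod_closed (mem (@sub_sort a));
  sub_coact : forall (a b : pi) (x : M (a * b)%g),
    @sub_sort (a * b)%g x -> tensor_subl (@sub_sort a) (coact M a b x)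
}.
Arguments sub_sort {C M} s a _.

(* The subcomodules of N, viewed as a comodule with the restricted coaction, *)
(* are the subcomodules of M contained in N.                                 *)
Definition simple_sub (C : picoalgebra) (M : picomodule C)
    (N : subcomodule M) : Prop :=
  (exists a, N a <> [set 0]) /\
  forall P : subcomodule M, (forall a, P a `<=` N a) ->
    (forall a, P a = [set 0]) \/ (forall a, P a = N a).

Definition sub_sum (C : picoalgebra) (M : picomodule C)
    (F : set (subcomodule M)) (a : pi) : set (M a) :=
  [set x | exists2 s : seq (M a),
     {in s, forall y, exists2 N : subcomodule M, F N & N a y} &
     x = \sum_(y <- s) y].

Arguments sub_sum {C M} F a _.

Definition cosemisimple_comodule (C : picoalgebra) (M : picomodule C) : Prop :=
  exists2 F : set (subcomodule M),
    (forall N, F N -> simple_sub N) & forall a, sub_sum F a = [set: M a].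

Definition cosemisimple (C : picoalgebra) : Prop :=
  cosemisimple_comodule (regular_comodule C).

Definition reduced (H : hopf_picoalgebra) (M : picomodule H) : Prop :=
  forall a, (forall h : H a, h = 0) -> forall m : M a, m = 0.

End PiCoalgebra.

(* Main.v *)
(* (b) => (c): let [N] be a subcomodule maximal among those not containing     *)
(* [1_1]. If [H] is a sum of simples then [N + k1 = H], and [k1] meets [N]     *)
(* trivially, so the projection onto [k1] along [N] provides the integral.     *)
(* (c) => (d): the indices [a] with [H_a != 0] form a subgroup of [pi], and    *)
(* evaluating the integral equation at [1] carries [lam_a(1_a) = 1] over it.   *)
(* (d) => (a): given a subcomodule [N] of [M] and a linear projection [f] of   *)
(* [M_1] onto [N_1], the maps [m |-> lam (S(f(m_0)_1) m_1) f(m_0)_0] form a    *)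
(* colinear projection of [M] onto [N]; they involve only [f] in degree 1,     *)
(* because the coaction sends [M_a] to [M_1 (x) H_a] and [N_1] to              *)
(* [N_a (x) H_{a^-1}]. Complements for all subcomodules give semisimplicity:   *)
(* if [P] is maximal among the subcomodules containing the socle but not a     *)
(* given [x], then any complement of [P] is simple, a contradiction.           *)

Require Import Defs.
From HB Require Import structures.
From mathcomp Require Import all_boot all_order all_algebra.
From mathcomp Require Import sesquilinear.
From mathcomp Require Import boolp classical_sets.

Set Implicit Arguments.
Unset Strict Implicit.
Unset Printing Implicit Defensive.

Import GRing.Theory.
Local Open Scope ring_scope.
Local Open Scope classical_set_scope.

(** * Sweedler calculus *)

(** This is Maschke's theorem, with a normalised integral as the averaging device. Sending [h] to
    [lam h] times the unit is then a colinear projection of [H] onto the subcomodule of lines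
    spanned by the units. If [H] is a sum of simples, [exists_supplement] supplies a subcomodule
    along which to project, and [cosemisimple_integral] reads the integral off.

    Conversely, the exchange rule [integral_anti], which comes from the antipode identity
    [cop_anti], makes the average of any linear map colinear ([average_coact]). Normalisation makes
    it fix whatever the linear map fixes ([average_id]). So every subcomodule is the image of a
    colinear projection, and [complemented_cosemisimple] turns this into simple summands by Zorn's
    lemma.

    The grading enters through the degrees with nonzero unit: they form a subgroup ([one_mul_neq0],
    [one_inv_neq0]), over which [integral_one] spreads the normalisation. *)

Section Multilinear.
Variable k : fieldType.
Implicit Types U V W X Y : lmodType k.

(* A folded [linear], which [multilin] below can recognize syntactically. *)
Definition linop U V (f : U -> V) : Prop := linear f.

Definition bilin U V W (g : U -> V -> W) : Prop :=
  (forall v, linop (g^~ v)) /\ (forall u, linop (g u)).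

Definition trilin U V W X (g : U -> V -> W -> X) : Prop :=
  (forall u, bilin (g u)) /\ (forall v w, linop (fun u => g u v w)).

(** Carrying the proof of linearity as an argument lets structure inference treat an anonymous
    function as a linear map. *)
Definition linop_map U V (f : U -> V) (_ : linop f) := f.
HB.instance Definition _ U V (f : U -> V) (lf : linop f) :=
  GRing.isLinear.Build k U V _ (linop_map lf) lf.

Definition bilin_map U V W (g : U -> V -> W) (_ : bilin g) := g.
Lemma bilin_mapP U V W (g : U -> V -> W) (bg : bilin g) :
  bilinear_for *:%R *:%R (bilin_map bg).
Proof. by case: (bg) => g1 g2; split=> u; [exact: g1|exact: g2]. Qed.
HB.instance Definition _ U V W (g : U -> V -> W) (bg : bilin g) :=
  bilinear_isBilinear.Build k U V W _ _ (bilin_map bg) (bilin_mapP bg).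

(* Sweedler notation: if [t] is the sum of the [t_1 (x) t_2], this is the sum  *)
(* of the [g t_1 t_2]. It is computed from an arbitrary representative of [t], *)
(* so it is meaningful only for bilinear [g].                                  *)
Definition sweedler V W X (t : V ⊗ W) (g : V -> W -> X) : X :=
  tensor_eval g (repr (t : tensor V W)).

Lemma sweedler_tens V W X (g : V -> W -> X) v w :
  bilin g -> sweedler (tens v w) g = g v w.
Proof. by move=> bg; rewrite /sweedler (tens_eval (bilin_map bg)). Qed.

Lemma linear_sweedler V W X Y (L : {linear X -> Y}) (t : V ⊗ W) g :
  L (sweedler t g) = sweedler t (fun v w => L (g v w)).
Proof. by rewrite /sweedler /tensor_eval linear_sum. Qed.

Lemma linop_sweedler_comm V W X Y (L : X -> Y) (t : V ⊗ W) g :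
  linop L -> L (sweedler t g) = sweedler t (fun v w => L (g v w)).
Proof. by move=> lL; rewrite -[L]/(linop_map lL : X -> Y) linear_sweedler. Qed.

Lemma sweedler_self V W (t : V ⊗ W) : t = sweedler t (fun v w => tens v w).
Proof. exact: tensor_sum. Qed.

Lemma eq_sweedler V W X (t : V ⊗ W) (g g' : V -> W -> X) :
  (forall v w, g v w = g' v w) -> sweedler t g = sweedler t g'.
Proof. by move=> e; apply: eq_bigr => p _. Qed.

Lemma exchange_sweedler V W V' W' X (t : V ⊗ W) (s : V' ⊗ W')
    (g : V -> W -> V' -> W' -> X) :
  sweedler t (fun v w => sweedler s (g v w)) =
  sweedler s (fun v' w' => sweedler t (fun v w => g v w v' w')).
Proof. exact: exchange_big. Qed.

Lemma linopZ U V (f : U -> V) c u : linop f -> f (c *: u) = c *: f u.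
Proof. by move=> lf; exact: (linearZ_LR (linop_map lf)). Qed.

Lemma linop_sum U V (f : U -> V) (I : Type) (s : seq I) (g : I -> U) :
  linop f -> f (\sum_(i <- s) g i) = \sum_(i <- s) f (g i).
Proof. by move=> lf; exact: (linear_sum (linop_map lf)). Qed.

Lemma linop_id U : linop (fun u : U => u). Proof. by []. Qed.

Lemma linop_comp U V W (L : {linear V -> W}) (f : U -> V) :
  linop f -> linop (fun u => L (f u)).
Proof. by move=> lf a x y; rewrite lf linearP. Qed.

Lemma linop_tensl U V W (f : U -> V) (w : W) :
  linop f -> linop (fun u => tens (f u) w : V ⊗ W).
Proof. by move=> lf a x y; rewrite lf tensPl. Qed.

Lemma linop_tensr U V W (f : U -> W) (v : V) :
  linop f -> linop (fun u => tens v (f u) : V ⊗ W).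
Proof. by move=> lf a x y; rewrite lf tensPr. Qed.

Lemma linop_scalel U V (f : U -> k^o) (v : V) :
  linop f -> linop (fun u => (f u : k) *: v).
Proof. by move=> lf a x y; rewrite lf scalerDl scalerA. Qed.

Lemma linop_scaler U V (f : U -> V) (c : k) :
  linop f -> linop (fun u => c *: f u).
Proof. by move=> lf a x y; rewrite lf scalerDr !scalerA mulrC. Qed.

Lemma linop_bilinl U V W X (b : {bilinear V -> W -> X}) (f : U -> V) w :
  linop f -> linop (fun u => b (f u) w).
Proof. by move=> lf a x y; rewrite lf linearPl. Qed.

Lemma linop_bilinr U V W X (b : {bilinear V -> W -> X}) (f : U -> W) v :
  linop f -> linop (fun u => b v (f u)).
Proof. by move=> lf a x y; rewrite lf linearPr. Qed.

Lemma linop_talgl U (A B : algebra k) (f : U -> A ⊗ B) y :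
  linop f -> linop (fun u => talg_mul (f u) y : A ⊗ B).
Proof. exact: (linop_bilinl (@talg_mul k A B)). Qed.

Lemma linop_talgr U (A B : algebra k) (f : U -> A ⊗ B) x :
  linop f -> linop (fun u => talg_mul x (f u) : A ⊗ B).
Proof. exact: (linop_bilinr (@talg_mul k A B)). Qed.

Lemma linop_sweedler U V W X (f : U -> V ⊗ W) (g : V -> W -> X) :
  linop f -> bilin g -> linop (fun u => sweedler (f u) g).
Proof.
move=> lf bg a x y; rewrite lf.
exact: (linearP (tlift (bilin_map bg))).
Qed.

Lemma linop_sweedler_fun U V W X (t : V ⊗ W) (g : U -> V -> W -> X) :
  (forall v w, linop (fun u => g u v w)) -> linop (fun u => sweedler t (g u)).
Proof.
move=> lg a x y; rewrite /sweedler /tensor_eval scaler_sumr -big_split /=.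
by apply: eq_bigr => p _; exact: lg.
Qed.

Lemma sweedler_tmap V V' W W' X (f : {linear V -> V'}) (h : {linear W -> W'})
    (t : V ⊗ W) (g : V' -> W' -> X) :
  bilin g -> sweedler (tmap f h t) g = sweedler t (fun v w => g (f v) (h w)).
Proof.
move=> bg; rewrite {1}[t]sweedler_self linear_sweedler.
rewrite (@linop_sweedler_comm _ _ _ _ (fun s => sweedler s g)); last first.
  exact: linop_sweedler.
by apply: eq_sweedler => v w /=; rewrite tmap_tens sweedler_tens.
Qed.

End Multilinear.

(** Proves linearity in each variable by peeling off the outermost operation until the variable
    itself remains; the generic [linop_comp] is tried last. *)
Ltac multilin :=
  repeat match goal with
  | |- trilin _ => split
  | |- bilin _ => split
  | |- forall _, _ => move=> ?
  end; cbv beta;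
  repeat first
    [ exact: linop_id
    | apply: linop_tensl | apply: linop_tensr
    | apply: linop_talgl | apply: linop_talgr
    | apply: linop_scalel
    | apply: linop_scaler
    | apply: linop_sweedler_fun => ? ?
    | apply: linop_sweedler; last by multilin
    | apply: linop_bilinl | apply: linop_bilinr
    | apply: linop_comp ].

(** * Subspaces and tensor products *)

(** [Zorn_bigcup] also asks about the empty chain, whose union is empty. Applying it to the sets [B]
    whose union with [A0] satisfies [P] makes that case harmless and keeps the maximal set above
    [A0]. *)
Lemma Zorn_above (T : Type) (P : set (set T)) (A0 : set T) : P A0 ->
  (forall F : set (set T), F !=set0 -> F `<=` P -> total_on F subset ->
     P (\bigcup_(X in F) X)) ->
  exists A, [/\ P A, A0 `<=` A & forall B, P B -> A `<=` B -> B `<=` A].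
Proof.
move=> PA0 chain.
have [F FQ totF|A [QA maxA]] := @Zorn_bigcup T [set B | P (A0 `|` B)].
  pose F' := [set A0 `|` X | X in set0 |` F].
  rewrite -[mkset _ _]/(P (A0 `|` \bigcup_(X in F) X)).
  have -> : A0 `|` \bigcup_(X in F) X = \bigcup_(X in F') X.
    apply/seteqP; split=> [x [A0x|[X FX Xx]]|x [_ [X [->|FX] <-]]].
    - by exists A0 => //; exists set0; [left|rewrite setU0].
    - by exists (A0 `|` X); [exists X; [right|]|right].
    - by rewrite setU0; left.
    - by case=> [A0x|Xx]; [left|right; exists X].
  apply: chain.
  - by exists A0, set0; [left|rewrite setU0].
  - by move=> _ [X [->|FX] <-]; [rewrite setU0|exact: FQ].
  - move=> _ _ [X FX <-] [Y FY <-].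
    have [XY|YX] : X `<=` Y \/ Y `<=` X.
    + case: FX FY => [->|FX] [->|FY]; [by left|by left|by right|exact: totF].
    + by left; apply: setUS.
    + by right; apply: setUS.
exists (A0 `|` A); split; [exact: QA|exact: subsetUl|move=> B PB sAB].
have sA0B : A0 `<=` B by move=> x A0x; apply: sAB; left.
apply: contrapT => nBA; apply: (maxA B); last first.
  rewrite /= (_ : A0 `|` B = B) //; apply/seteqP.
  by split=> [x [/sA0B|]|x]; [| |right].
split=> [x Ax|BA]; first by apply: sAB; right.
by apply: nBA => x /BA; right.
Qed.

Section Subspaces.
Variable k : fieldType.
Implicit Types U V W : lmodType k.

Definition subspace V (X : set V) : Prop :=
  X 0 /\ forall (a : k) x y, X x -> X y -> X (a *: x + y).

Lemma subspaceP V (X : set V) : subspace X <-> submod_closed (mem X).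
Proof.
split=> [[X0 XD]|[X0 XD]].
  by split=> [|a x y]; rewrite ?inE //; exact: XD.
split=> [|a x y Xx Xy]; first by rewrite inE in X0.
by have := XD a x y; rewrite !inE; apply.
Qed.

Section SubspaceTheory.
Variables (V : lmodType k) (X : set V).
Hypothesis sX : subspace X.

Lemma subspace0 : X 0. Proof. by case: sX. Qed.
Lemma subspaceD x y : X x -> X y -> X (x + y).
Proof. by move=> Xx Xy; rewrite -[x]scale1r; exact: sX.2. Qed.
Lemma subspaceZ (a : k) x : X x -> X (a *: x).
Proof.
by move=> Xx; rewrite -[_ *: _]addr0; apply: sX.2 => //; exact: sX.1.
Qed.
Lemma subspaceB x y : X x -> X y -> X (x - y).
Proof. by move=> Xx Xy; rewrite addrC -scaleN1r; exact: sX.2. Qed.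
Lemma subspace_sum (I : eqType) (s : seq I) (g : I -> V) :
  {in s, forall i, X (g i)} -> X (\sum_(i <- s) g i).
Proof.
move=> Xs; rewrite big_seq; apply: big_ind => //; first exact: subspace0.
exact: subspaceD.
Qed.
End SubspaceTheory.

Lemma subspace_sweedler U V W (Y : set U) (t : V ⊗ W) (g : V -> W -> U) :
  subspace Y -> (forall v w, Y (g v w)) -> Y (sweedler t g).
Proof. by move=> sY Yg; apply: subspace_sum => // p _. Qed.

Lemma subspace_line V (v : V) : subspace [set u | exists c : k, u = c *: v].
Proof.
split=> [|a _ _ [c ->] [d ->]]; first by exists 0; rewrite scale0r.
by exists (a * c + d); rewrite scalerDl scalerA.
Qed.

Lemma subspace_zero V : subspace [set (0 : V)].
Proof. by split=> // a x y -> ->; rewrite scaler0 addr0. Qed.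

Lemma subspace_add V (X Y : set V) : subspace X -> subspace Y ->
  subspace [set v | exists2 x, X x & exists2 y, Y y & v = x + y].
Proof.
move=> sX sY; split.
  by exists 0; [exact: subspace0|exists 0; [exact: subspace0|rewrite addr0]].
move=> a _ _ [x Xx [y Yy ->]] [x' Xx' [y' Yy' ->]].
exists (a *: x + x'); first exact: sX.2.
exists (a *: y + y'); first exact: sY.2.
by rewrite scalerDr addrACA.
Qed.

(** A maximal subspace [W'] containing [W] and independent of [X] is a complement of [X]; the
    projection along it is linear because components are unique. *)
Lemma linear_projection V (X W : set V) : subspace X -> subspace W ->
  (forall v, X v -> W v -> v = 0) ->
  exists p : {linear V -> V}, [/\ forall v, X (p v),
    forall v, X v -> p v = v & forall v, W v -> p v = 0].
Proof.
move=> sX sW XW.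
pose P (B : set V) := subspace B /\ forall v, X v -> B v -> v = 0.
have [//|F [B0 FB0] FP totF|W' [[sW' XW'] WW' maxW']] := @Zorn_above V P W.
  split=> [|v Xv [B FB Bv]]; last exact: (FP _ FB).2.
  split=> [|a x y [B FB Bx] [B' FB' B'y]].
    by exists B0 => //; exact: (FP _ FB0).1.1.
  have [BB'|B'B] := totF _ _ FB FB'.
    by exists B' => //; apply: (FP _ FB').1.2 => //; exact: BB'.
  by exists B => //; apply: (FP _ FB).1.2 => //; exact: B'B.
have span v : exists x, X x /\ W' (v - x).
  (* Otherwise adding the line of [v] to [W'] keeps it independent of [X], against maximality. *)
  apply: contrapT => nv.
  pose B := [set u | exists2 w, W' w &
    exists2 l, (exists c : k, l = c *: v) & u = w + l].
  have B0 w : W' w -> B w.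
    move=> Ww; exists w => //; exists 0; last by rewrite addr0.
    by exists 0; rewrite scale0r.
  have Bv : B v.
    exists 0; [exact: subspace0|exists v; last by rewrite add0r].
    by exists 1; rewrite scale1r.
  have PB : P B.
    split; first by apply: subspace_add => //; exact: subspace_line.
    move=> u Xu [w Ww [_ [c ->] e]].
    have [c0|c0] := eqVneq c 0.
      by apply: XW' => //; rewrite e c0 scale0r addr0.
    exfalso; apply: nv; exists (c^-1 *: u); split; first exact: subspaceZ.
    rewrite -[v in v - _](scalerK c0) -scalerBr; apply: subspaceZ => //.
    by rewrite e opprD addrCA subrr addr0 -scaleN1r; exact: subspaceZ.
  apply: nv; exists 0; split; first exact: subspace0.
  by rewrite subr0; exact: (maxW' B).
have [p pP] := choice span.
have lp : linop p.
  move=> a u v; apply/eqP; rewrite -subr_eq0; apply/eqP; apply: XW'.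
    by apply: subspaceB; [|exact: (pP _).1|apply: sX.2; exact: (pP _).1].
  have -> : p (a *: u + v) - (a *: p u + p v) =
      (a *: (u - p u) + (v - p v)) - (a *: u + v - p (a *: u + v)).
    by rewrite scalerBr addrACA -opprD opprB [RHS]addrC addrA subrK.
  by apply: subspaceB; [|apply: sW'.2; exact: (pP _).2|exact: (pP _).2].
have pE v x : X x -> W' (v - x) -> p v = x.
  move=> Xx Wx; apply/eqP; rewrite -subr_eq0; apply/eqP; apply: XW'.
    by apply: subspaceB => //; exact: (pP v).1.
  have -> : p v - x = (v - x) - (v - p v).
    by rewrite opprB [RHS]addrC addrA subrK.
  by apply: subspaceB => //; exact: (pP v).2.
exists (linop_map lp); split=> v; rewrite ?/linop_map /=.
- exact: (pP v).1.
- by move=> Xv; apply: pE => //; rewrite subrr; exact: subspace0.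
- by move=> Wv; apply: pE; [exact: subspace0|rewrite subr0; exact: WW'].
Qed.

(** The coordinate along [v] of a projection onto its line that kills [W]. *)
Lemma separating_functional V (W : set V) v : subspace W -> ~ W v ->
  exists2 phi : {linear V -> k^o}, phi v = 1 & forall w, W w -> phi w = 0.
Proof.
move=> sW nWv.
have v0 : v != 0 by apply/eqP => v0; apply: nWv; rewrite v0; exact: subspace0.
have [|p [pX pid p0]] := linear_projection (subspace_line v) sW.
  move=> _ [c ->] Wcv; have [->|c0] := eqVneq c 0; first by rewrite scale0r.
  by exfalso; apply: nWv; rewrite -(scalerK c0 v); exact: subspaceZ.
have [phi phiP] := choice pX.
have inj (c d : k) : c *: v = d *: v -> c = d.
  move/eqP; rewrite -subr_eq0 -scalerBl scaler_eq0 (negPf v0) orbF subr_eq0.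
  by move/eqP.
have lphi : linop (phi : V -> k^o).
  move=> a x y; apply: inj; rewrite -phiP linearP /= !phiP.
  by rewrite [in RHS]scalerDl scalerA.
exists (linop_map lphi) => [|w Ww]; apply: inj; rewrite /linop_map -phiP.
  by rewrite scale1r pid //; exists 1; rewrite scale1r.
by rewrite p0 // scale0r.
Qed.

Lemma tens_eq0 V W (v : V) (w : W) : tens v w = 0 :> V ⊗ W -> v = 0 \/ w = 0.
Proof.
move=> vw0; have [->|w0] := pselect (w = 0); [by right|left].
have [phi phiw _] := separating_functional (subspace_zero W) w0.
have := congr1 (fun t => tunitr (tmap idfun phi t)) vw0.
by rewrite tmap_tens tunitr_tens phiw scale1r !linear0.
Qed.

(** * Subspaces of the left tensor factor *)

Section TensorSubl.
Variables (V W : lmodType k).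

Lemma tensor_subl_tens (X : set V) v (w : W) : X v -> tensor_subl X (tens v w).
Proof.
move=> Xv; exists [:: (v, w)]; last by rewrite big_seq1.
by move=> p; rewrite inE => /eqP ->.
Qed.

Lemma tensor_sublS (X Y : set V) : X `<=` Y ->
  tensor_subl X `<=` tensor_subl (W := W) Y.
Proof. by move=> XY _ [s Xs ->]; exists s => // p /Xs /XY. Qed.

Lemma subspace_tensor_subl (X : set V) : subspace X ->
  subspace (tensor_subl X : set (V ⊗ W)).
Proof.
move=> sX; split; first by exists [::]; rewrite ?big_nil.
move=> a _ _ [s Xs ->] [t Xt ->].
exists ([seq (a *: p.1, p.2) | p <- s] ++ t).
  move=> p; rewrite mem_cat => /orP[/mapP[q qs ->]|]; last exact: Xt.
  by apply: subspaceZ => //; exact: Xs.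
rewrite big_cat big_map /= scaler_sumr; congr (_ + _).
by apply: eq_bigr => p _; rewrite -linearZl_LR.
Qed.

Lemma linear_tensor_subl (U : lmodType k) (X : set V) (Y : set U)
    (L : V ⊗ W -> U) t :
  linop L -> subspace Y -> (forall v w, X v -> Y (L (tens v w))) ->
  tensor_subl X t -> Y (L t).
Proof.
move=> lL sY XY [s Xs ->].
by rewrite linop_sum //; apply: subspace_sum => // p /Xs; exact: XY.
Qed.

Lemma eq_tensor_subl (U : lmodType k) (X : set V) (L L' : V ⊗ W -> U) t :
  linop L -> linop L' ->
  (forall v w, X v -> L (tens v w) = L' (tens v w)) ->
  tensor_subl X t -> L t = L' t.
Proof.
move=> lL lL' XLL' [s Xs ->].
by rewrite !linop_sum // !big_seq; apply: eq_bigr => p /Xs; exact: XLL'.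
Qed.

(* A projection onto [X] killing a complement of [X `&` Y] in [Y] maps         *)
(* [Y (x) W] into [(X `&` Y) (x) W] and fixes [X (x) W].                       *)
Lemma tensor_subl_setI (X Y : set V) (t : V ⊗ W) : subspace X -> subspace Y ->
  tensor_subl X t -> tensor_subl Y t -> tensor_subl (X `&` Y) t.
Proof.
move=> sX sY Xt Yt.
have sXY : subspace (X `&` Y).
  split=> [|a x y [Xx Yx] [Xy Yy]]; first by split; exact: subspace0.
  by split; [exact: sX.2|exact: sY.2].
have [|q [qXY qid _]] := linear_projection sXY (subspace_zero V).
  by move=> v _ ->.
(* [Y'] is a complement of the intersection inside [Y]: it meets [X] trivially because [q] fixes the
   intersection. *)
pose Y' := [set y | Y y /\ q y = 0].
have sY' : subspace Y'.
  split=> [|a x y [Yx qx] [Yy qy]].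
    by split; [exact: subspace0|exact: linear0].
  by split; [exact: sY.2|rewrite linearP qx qy scaler0 addr0].
have [|p [_ pid p0]] := linear_projection sX sY'.
  by move=> v Xv [Yv <-]; rewrite qid.
have -> : t = tmap p idfun t.
  apply: (eq_tensor_subl (L := id)) Xt => //; first exact: linop_comp.
  by move=> v w Xv; rewrite tmap_tens /= pid.
apply: (linear_tensor_subl (L := tmap p idfun)) Yt; first exact: linop_comp.
  exact: subspace_tensor_subl.
move=> v w Yv; rewrite tmap_tens; apply: tensor_subl_tens => /=.
have [Xqv Yqv] := qXY v.
have -> : p v = q v; last by [].
rewrite -[v in LHS](subrK (q v)) linearD /= (pid (q v)) // p0 ?add0r //.
by split; [exact: subspaceB|rewrite linearB /= (qid (q v)) ?subrr].
Qed.
End TensorSubl.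
End Subspaces.

(** * Subcomodules and semisimplicity *)

Section Subcomodules.
Variables (pi : groupType) (k : fieldType) (C : picoalgebra pi k).
Variable M : picomodule C.
Implicit Types N P Q L : forall a : pi, set (M a).

Arguments sub_sort {_ _ _ _} s a _.

(** Stated on bare families of sets, so that families can be compared, added and fed to Zorn's
    lemma; [is_sub_sub] returns to the record. *)
Definition is_sub N : Prop := (forall a, subspace (N a)) /\
  forall (a b : pi) (x : M (a * b)%g), N (a * b)%g x ->
    tensor_subl (N a) (coact M a b x).

Definition colinear (F : forall a, {linear M a -> M a}) : Prop :=
  forall (a b : pi) (x : M (a * b)%g),
    tmap (F a) idfun (coact M a b x) = coact M a b (F (a * b)%g x).

Definition is_proj N (F : forall a, {linear M a -> M a}) : Prop :=
  forall a x, N a (F a x) /\ (N a x -> F a x = x).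

Definition zero_family (a : pi) : set (M a) := [set 0].
Definition add_family N P a : set (M a) :=
  [set v | exists2 x, N a x & exists2 y, P a y & v = x + y].

Arguments add_family : clear implicits.

Lemma sub_is_sub (S : subcomodule M) : is_sub (sub_sort S).
Proof.
split=> [a|a b x Sx]; last exact: sub_coact.
exact: ((subspaceP (sub_sort S a)).2 (@sub_submod _ _ _ _ S a)).
Qed.

Lemma is_sub_sub N : is_sub N -> exists S : subcomodule M, sub_sort S = N.
Proof.
move=> [sN NC]; have sN' a := (subspaceP (N a)).1 (sN a).
by exists (@SubComodule _ _ _ _ N sN' NC).
Qed.

Lemma is_sub_zero : is_sub zero_family.
Proof.
split=> [a|a b x ->]; first exact: subspace_zero.
rewrite linear0; apply: subspace0; apply: subspace_tensor_subl.
exact: subspace_zero.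
Qed.

Lemma is_sub_add N P : is_sub N -> is_sub P -> is_sub (add_family N P).
Proof.
move=> [sN NC] [sP PC]; split=> [a|a b _ [x Nx [y Py ->]]].
  exact: subspace_add.
rewrite linearD; apply: subspaceD.
- by apply: subspace_tensor_subl; exact: subspace_add.
- apply: tensor_sublS (NC _ _ _ Nx) => u Nu.
  by exists u => //; exists 0; [exact: subspace0|rewrite addr0].
- apply: tensor_sublS (PC _ _ _ Py) => u Pu.
  by exists 0; [exact: subspace0|exists u; rewrite ?add0r].
Qed.

Lemma is_sub_setI N P : is_sub N -> is_sub P -> is_sub (fun a => N a `&` P a).
Proof.
move=> [sN NC] [sP PC]; split=> [a|a b x [Nx Px]].
  split=> [|c x y [Nx Px] [Ny Py]]; first by split; exact: subspace0.
  by split; [exact: (sN a).2|exact: (sP a).2].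
by apply: tensor_subl_setI => //; [exact: NC|exact: PC].
Qed.

Lemma is_sub_sum (S : set (subcomodule M)) : is_sub (@sub_sum _ _ _ M S).
Proof.
have sS a : subspace (@sub_sum _ _ _ M S a).
  split=> [|c _ _ [s Ss ->] [t St ->]]; first by exists [::]; rewrite ?big_nil.
  exists ([seq c *: y | y <- s] ++ t).
    move=> y; rewrite mem_cat => /orP[/mapP[z zs ->]|]; last exact: St.
    have [N SN Nz] := Ss _ zs; exists N => //.
    exact: subspaceZ ((sub_is_sub N).1 a) _ _ Nz.
  by rewrite big_cat big_map scaler_sumr.
split=> // a b _ [s Ss ->]; rewrite linear_sum.
apply: subspace_sum; first exact: subspace_tensor_subl.
move=> y /Ss[N SN Ny]; apply: tensor_sublS ((sub_is_sub N).2 _ _ _ Ny).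
move=> u Nu; exists [:: u]; last by rewrite big_seq1.
by move=> _ /[!inE] /eqP ->; exists N.
Qed.

(** The map [id - F] commutes with the coaction, so it sends subcomodules to subcomodules. When [P]
    contains [N], the result is a complement of [N] in [P]. *)
Lemma is_sub_coimage N P F : is_sub P -> is_proj N F -> colinear F ->
  is_sub (fun a => [set x - F a x | x in P a]).
Proof.
move=> [sP PC] NF FC.
have sI a : subspace [set x - F a x | x in P a].
  split; first by exists 0; [exact: subspace0|rewrite linear0 subr0].
  move=> c _ _ [x Px <-] [y Py <-]; exists (c *: x + y); first exact: (sP a).2.
  by rewrite linearP opprD addrACA scalerBr.
split=> // a b _ [x Px <-]; rewrite linearB -FC.
apply: (linear_tensor_subl (L := fun t => t - tmap (F a) idfun t))
  (PC _ _ _ Px).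
- by move=> c t t'; rewrite linearP opprD addrACA scalerBr.
- exact: subspace_tensor_subl.
move=> v w Pv; rewrite tmap_tens /= -linearBl; apply: tensor_subl_tens.
by exists v.
Qed.

(** A family of sets is encoded as one set in the disjoint union of the [M a], where the union of a
    nonempty chain of subcomodules is again one. *)
Lemma is_sub_Zorn N a0 x0 : is_sub N -> ~ N a0 x0 -> exists P,
  [/\ is_sub P, forall a, N a `<=` P a, ~ P a0 x0 &
    forall Q, is_sub Q -> (forall a, P a `<=` Q a) -> ~ Q a0 x0 ->
      forall a, Q a `<=` P a].
Proof.
move=> sN nN.
pose fam (B : set {a : pi & M a}) a := [set m | B (existT _ a m)].
pose tot Q : set {a : pi & M a} := [set m | Q (tag m) (tagged m)].
have [|S S0 SP totS|B [[sB nB] NB maxB]] := @Zorn_above _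
    [set B | is_sub (fam B) /\ ~ B (existT _ a0 x0)] (tot N); first by split.
- have [B0 SB0] := S0.
  split; last by move=> [B SB]; exact: (SP _ SB).2.
  split=> [a|a b x [B SB Bx]].
    split=> [|c x y [B SB Bx] [B' SB' B'y]].
      by exists B0 => //; exact: ((SP _ SB0).1.1 a).1.
    have [BB'|B'B] := totS _ _ SB SB'.
      by exists B' => //; apply: ((SP _ SB').1.1 a).2 => //; exact: BB'.
    by exists B => //; apply: ((SP _ SB).1.1 a).2 => //; exact: B'B.
  by apply: tensor_sublS ((SP _ SB).1.2 _ _ _ Bx) => u Bu; exists B.
exists (fam B); split=> // [a x Nx|Q sQ BQ nQ a x Qx]; first exact: NB.
by apply: (maxB (tot Q)) => // -[b y]; exact: BQ.
Qed.

(** Let [P] be maximal above the socle and missing [x0], with complement [Q]. By maximality every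
    nonzero subcomodule of [Q] contains the [Q]-component [y0] of [x0]. Two independent ones cannot
    both do so, hence [Q] is simple and lies in the socle, although it is independent of [P]. *)
Lemma complemented_cosemisimple :
  (forall N, is_sub N -> exists2 F, is_proj N F & colinear F) ->
  cosemisimple_comodule M.
Proof.
move=> compl.
pose S := sub_sum (@simple_sub _ _ _ M).
exists (@simple_sub _ _ _ M) => // a0; apply/seteqP; split=> // x0 _.
apply: contrapT => nSx.
have [P [sP SP nPx maxP]] := is_sub_Zorn (is_sub_sum _) nSx.
have [F PF FC] := compl _ sP.
have sT : is_sub (fun a => setT : set (M a)).
  split=> // a b x _; rewrite [coact M a b x]tensor_sum.
  by exists (repr (coact M a b x : tensor _ _)).
(* The image of [id - F] is the kernel of [F], a complement of [P]. *)
have sQ := is_sub_coimage sT PF FC.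
set Q := (fun a => _) in sQ.
have FQ a y : Q a y -> F a y = 0.
  move=> [z _ <-]; rewrite linearB /= (PF a (F a z)).2 ?subrr //.
  exact: (PF a z).1.
have nPQ a y : P a y -> Q a y -> y = 0.
  by move=> Py /FQ <-; rewrite (PF a y).2.
pose y0 := x0 - F a0 x0.
have y0E x y : P a0 x -> Q a0 y -> x0 = x + y -> y0 = y.
  move=> Px Qy xy; rewrite /y0 xy linearD /= (PF a0 x).2 // (FQ a0 y) //.
  by rewrite addr0 addrC addKr.
have y0n0 : y0 <> 0.
  move=> y00; apply: nPx; rewrite -(subrK (F a0 x0) x0) -/y0 y00 add0r.
  exact: (PF _ _).1.
have Qy0 : Q a0 y0 by exists x0.
have [T eT] := is_sub_sub sQ.
have simpT : simple_sub T.
  rewrite /simple_sub eT; split.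
    by exists a0 => Q0; apply: y0n0; rewrite Q0 in Qy0.
  move=> R RQ; apply: contrapT => /not_orP[R0 nRQ].
  have sR := sub_is_sub R.
  have Ry0 : sub_sort R a0 y0.
    have [[x Px [y Ry xy]]|nx] := pselect (add_family P (sub_sort R) a0 x0).
      by rewrite (y0E _ _ Px (RQ _ _ Ry) xy).
    exfalso; apply: R0 => a; apply/seteqP; split=> [y Ry|y ->]; last first.
      by apply: subspace0; exact: sR.1.
    apply: nPQ (RQ a y Ry).
    apply: maxP (is_sub_add sP sR) _ nx _ _ _ => [b z Pz|].
      by exists z => //; exists 0; [exact: subspace0 (sR.1 b)|rewrite addr0].
    by exists 0; [exact: subspace0 (sP.1 a)|exists y; rewrite ?add0r].
  (* [R'] is a complement of [R] in [Q]. If it were nonzero it would contain [y0] too, forcing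
     [y0 = 0]; so it vanishes and [R] is all of [Q]. *)
  have [G RG GC] := compl _ sR.
  have sR' := is_sub_coimage sQ RG GC.
  set R' := (fun a => _) in sR'.
  have R'Q a : R' a `<=` Q a.
    move=> _ [y Qy <-]; apply: subspaceB => //; first exact: sQ.1.
    by apply: RQ; exact: (RG a y).1.
  have [[x Px [y R'y xy]]|nx] := pselect (add_family P R' a0 x0).
    apply: y0n0.
    have y0y := y0E _ _ Px (R'Q _ _ R'y) xy.
    have <- := (RG _ y0).2 Ry0; rewrite y0y; case: R'y => z Qz <-.
    by rewrite linearB /= (RG _ (G a0 z)).2 ?subrr //; exact: (RG _ z).1.
  apply: nRQ => a; apply/seteqP; split=> [|y Qy]; first exact: RQ.
  have R'0 : y - G a y = 0.
    have R'y : R' a (y - G a y) by exists y.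
    apply: nPQ (R'Q _ _ R'y).
    apply: maxP (is_sub_add sP sR') _ nx _ _ _ => [b z Pz|].
      by exists z => //; exists 0; [exact: subspace0 (sR'.1 b)|rewrite addr0].
    by exists 0; [exact: subspace0 (sP.1 a)|exists (y - G a y); rewrite ?add0r].
  by rewrite -(subrK (G a y) y) R'0 add0r; exact: (RG a y).1.
apply: y0n0; apply: (nPQ _ _ _ Qy0); apply: SP; exists [:: y0].
  by move=> _ /[!inE] /eqP ->; exists T; [exact: simpT|rewrite eT].
by rewrite big_seq1.
Qed.

(** Take [N] maximal missing [x0]. A simple [T] not inside [N] gives [x0 = n + t], so [t = x0 - n]
    is a nonzero element of [T] in [N + L], and simplicity puts all of [T] there. *)
Lemma exists_supplement L a0 x0 : cosemisimple_comodule M -> is_sub L ->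
  L a0 x0 -> x0 <> 0 ->
  exists N, [/\ is_sub N, ~ N a0 x0 & forall a x, add_family N L a x].
Proof.
move=> [S Ssimple SM] sL Lx x0n0.
have [N [sN _ nNx maxN]] := is_sub_Zorn is_sub_zero x0n0.
exists N; split=> // a x.
have sNL := is_sub_add sN sL.
have : sub_sum S x by rewrite SM.
case=> s Ss ->; apply: subspace_sum; first exact: sNL.1.
move=> y /Ss[T /Ssimple[_ simpT] Ty].
have sT := sub_is_sub T.
have NNL b : N b `<=` add_family N L b.
  move=> z Nz; exists z => //.
  by exists 0; [exact: subspace0 (sL.1 b)|rewrite addr0].
have [[n Nn [t Tt e]]|nx] := pselect (add_family N (sub_sort T) a0 x0);
  last first.
  apply: NNL; apply: maxN (is_sub_add sN sT) _ nx _ _ _ => [b z Nz|].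
    by exists z => //; exists 0; [exact: subspace0 (sT.1 b)|rewrite addr0].
  by exists 0; [exact: subspace0 (sN.1 a)|exists y; rewrite ?add0r].
have [R eR] := is_sub_sub (is_sub_setI sT sNL).
have [|R0|RT] := simpT R.
- by move=> b z; rewrite eR => -[].
- exfalso; apply: nNx; rewrite e (_ : t = 0) ?addr0 //.
  suff : sub_sort R a0 t by rewrite R0.
  rewrite eR; split=> //; have -> : t = x0 - n by rewrite e addrC addKr.
  exists (- n); first by rewrite -scaleN1r; exact: subspaceZ (sN.1 a0) _ _ Nn.
  by exists x0 => //; rewrite addrC.
- have : sub_sort R a y by rewrite RT.
  by rewrite eR => -[].
Qed.

End Subcomodules.

(** * Coactions and the antipode *)

Section Coassociativity.
Variables (pi : groupType) (k : fieldType) (C : picoalgebra pi k).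

(** The degree [c] is free and comes with an equation, so that equal but not convertible degrees can
    be used without visible transports. *)
Definition coact_at (M : picomodule C) a b c (e : c = (a * b)%g) :
  {linear M c -> M a ⊗ C b} := coact M a b \o transp_linear M e.

Definition comul_at a b c (e : c = (a * b)%g) : {linear C c -> C a ⊗ C b} :=
  comul C a b \o transp_linear C e.

Lemma transp_irr (V : pi -> lmodType k) a b (e e' : a = b) (x : V a) :
  transp e x = transp e' x.
Proof. by congr transp; exact: Prop_irrelevance. Qed.

Lemma coact_atA (M : picomodule C) a b c d ab bc (eab : ab = (a * b)%g)
    (ebc : bc = (b * c)%g) (e1 : d = (ab * c)%g) (e2 : d = (a * bc)%g)
    (X : lmodType k) (g : M a -> C b -> C c -> X) (x : M d) :
  trilin g ->
  sweedler (coact_at M e1 x) (fun u w =>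
    sweedler (coact_at M eab u) (fun y z => g y z w)) =
  sweedler (coact_at M e2 x) (fun y v =>
    sweedler (comul_at ebc v) (fun z w => g y z w)).
Proof.
move=> [g23 g1].
have gl y : bilin (g y) := g23 y.
have bg : bilin (fun y (v : C b ⊗ C c) => sweedler v (g y)).
  split=> [v|y]; first exact: linop_sweedler_fun.
  exact: linop_sweedler.
(* [T] is the linear map induced by [g] on the triple tensor product, to be applied to both sides of
   coassociativity. *)
pose T (t : M a ⊗ (C b ⊗ C c)) := sweedler t (fun y v => sweedler v (g y)).
have lT : linop T by apply: linop_sweedler => //; exact: linop_id.
subst ab bc; subst d; have := congr1 T (coactA x).
rewrite {2}/T sweedler_tmap //= (transp_irr _ e2) => <-.
set s := coact M _ c x; rewrite /coact_at /= -/s.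
have lT' : linop (fun t => T (tassoc (tmap (coact M a b) idfun t))).
  by move=> r t t'; rewrite !linearP lT.
rewrite [in RHS](sweedler_self s) (linop_sweedler_comm _ _ lT').
apply: eq_sweedler => u w; rewrite tmap_tens /=.
have lT2 : linop (fun t => T (tassoc (tens t w))).
  by move=> r t t'; rewrite tensPl linearP lT.
rewrite [in RHS](sweedler_self (coact M a b u)) (linop_sweedler_comm _ _ lT2).
by apply: eq_sweedler => y z; rewrite tassoc_tens /T !sweedler_tens.
Qed.

Lemma transp_id (V : pi -> lmodType k) a (e : a = a) (x : V a) :
  transp e x = x.
Proof. by rewrite (transp_irr e erefl). Qed.

Lemma coact_at_counit (M : picomodule C) a (e : a = (a * 1)%g) (x : M a) :
  sweedler (coact_at M e x) (fun m c => (counit C c : k) *: m) = x.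
Proof.
have := coact1 (transp e x); have -> : transp (mulg1 a) (transp e x) = x.
  by case: _ / e (mulg1 a) => e; exact: transp_id.
rewrite /coact_at /=; set t := coact M a 1%g _ => <-.
have lU : linop (fun s => tunitr (tmap idfun (counit C) s) : M a).
  by move=> r s s'; rewrite !linearP.
rewrite [in RHS](sweedler_self t) (linop_sweedler_comm _ _ lU).
by apply: eq_sweedler => m c; rewrite tmap_tens tunitr_tens.
Qed.

End Coassociativity.

(** * Antipode and integral in Sweedler notation *)

Section HopfSweedler.
Variables (pi : groupType) (k : fieldType) (H : hopf_picoalgebra pi k).

Notation "x * y" := (alg_mul _ x y) : ring_scope.
Notation one a := (alg_one (H a)).
Notation "x *t y" := (talg_mul x y) (at level 40, left associativity).

Definition cop a b c (e : c = (a * b)%g) : {linear H c -> H a ⊗ H b} :=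
  @comul_at pi k H a b c e.

Definition eps : {linear H 1%g -> k^o} := counit H.

(** The antipode indexed by its target, with the double inverse of [a] identified with [a]. *)
Definition anti a : {linear H a^-1%g -> H a} :=
  transp_inv H a \o @antipode pi k H a^-1%g.

Lemma copA a b c d ab bc (eab : ab = (a * b)%g)
    (ebc : bc = (b * c)%g) (e1 : d = (ab * c)%g) (e2 : d = (a * bc)%g)
    (X : lmodType k) (g : H a -> H b -> H c -> X) (x : H d) :
  trilin g ->
  sweedler (cop e1 x) (fun u w => sweedler (cop eab u) (fun y z => g y z w)) =
  sweedler (cop e2 x) (fun y v => sweedler (cop ebc v) (fun z w => g y z w)).
Proof. exact: (@coact_atA _ _ _ (regular_comodule H)). Qed.

Lemma cop_counitl a (e : a = (1 * a)%g) (x : H a) :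
  sweedler (cop e x) (fun c y => (eps c : k) *: y) = x.
Proof.
have := pc_counitl (pc_struct H) (transp e (x : hopf_coalg H a)).
have -> : transp (mul1g a) (transp e (x : hopf_coalg H a)) = x.
  by case: _ / e (mul1g a) => e; exact: transp_id.
rewrite /cop /comul_at /=; set t := pc_comul _ 1%g _ _ => <-.
have lU : linop (fun s => tunitl (tmap (counit H) idfun s) : H a).
  by move=> r s s'; rewrite !linearP.
rewrite [in RHS](sweedler_self t) (linop_sweedler_comm _ _ lU).
by apply: eq_sweedler => m c; rewrite tmap_tens tunitl_tens.
Qed.

Lemma cop_counitr a (e : a = (a * 1)%g) (x : H a) :
  sweedler (cop e x) (fun y c => (eps c : k) *: y) = x.
Proof. exact: (@coact_at_counit _ _ _ (regular_comodule H)). Qed.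

Lemma cop_antil a (e : 1%g = (a^-1 * a)%g) (x : H 1%g) :
  sweedler (cop e x) (fun g h => anti a g * h) = (eps x : k) *: one a.
Proof.
rewrite -antipodel [in RHS](transp_irr _ e).
rewrite /cop /comul_at /=; set t := pc_comul _ _ _ _.
rewrite [in RHS](sweedler_self t).
have lU : linop (fun s => tmul (tmap (anti a) idfun s) : H a).
  by move=> r s s'; rewrite !linearP.
rewrite (linop_sweedler_comm _ _ lU).
by apply: eq_sweedler => g h; rewrite tmap_tens tmul_tens.
Qed.

Lemma cop_antir a (e : 1%g = (a * a^-1)%g) (x : H 1%g) :
  sweedler (cop e x) (fun g h => g * anti a h) = (eps x : k) *: one a.
Proof.
rewrite -antipoder [in RHS](transp_irr _ e).
rewrite /cop /comul_at /=; set t := pc_comul _ _ _ _.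
rewrite [in RHS](sweedler_self t).
have lU : linop (fun s => tmul (tmap idfun (anti a) s) : H a).
  by move=> r s s'; rewrite !linearP.
rewrite (linop_sweedler_comm _ _ lU).
by apply: eq_sweedler => g h; rewrite tmap_tens tmul_tens.
Qed.

Lemma cop1 a b c (e : c = (a * b)%g) : cop e (one c) = tens (one a) (one b).
Proof. by subst c; have [h1 hM] := hopf_comul_morph H a b; exact: h1. Qed.

Lemma copM a b c (e : c = (a * b)%g) (x y : H c) :
  cop e (x * y) = cop e x *t cop e y.
Proof. by subst c; have [h1 hM] := hopf_comul_morph H a b; exact: hM. Qed.

Lemma eps1 : eps (one 1%g) = 1.
Proof. by have [h1 hM] := hopf_counit_morph H; exact: h1. Qed.

Definition hcoact (M : picomodule H) a b c (e : c = (a * b)%g) :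
  {linear M c -> M a ⊗ H b} := @coact_at pi k H M a b c e.

Lemma hcoactA (M : picomodule H) a b c d ab bc (eab : ab = (a * b)%g)
    (ebc : bc = (b * c)%g) (e1 : d = (ab * c)%g) (e2 : d = (a * bc)%g)
    (X : lmodType k) (g : M a -> H b -> H c -> X) (x : M d) :
  trilin g ->
  sweedler (hcoact M e1 x) (fun u w =>
    sweedler (hcoact M eab u) (fun y z => g y z w)) =
  sweedler (hcoact M e2 x) (fun y v =>
    sweedler (cop ebc v) (fun z w => g y z w)).
Proof. exact: coact_atA. Qed.

Lemma hcoact_counit (M : picomodule H) a (e : a = (a * 1)%g) (x : M a) :
  sweedler (hcoact M e x) (fun m c => (eps c : k) *: m) = x.
Proof. exact: coact_at_counit. Qed.

(* Instead of [Delta (S g) = S g_2 (x) S g_1] it is enough to know             *)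
(* [S(x_2)_1 (x) x_1 S(x_2)_2 = S x (x) 1]; this follows by expanding the right*)
(* side as [(S x_1 (x) 1) Delta(x_2) Delta(S x_3)].                            *)
Lemma cop_anti a b c (ec : c = (a * b)%g) (e : a^-1%g = (b * c^-1)%g)
    (x : H a^-1%g) :
  sweedler (cop e x) (fun y g => tens (one a) y *t cop ec (anti c g)) =
  tens (anti a x) (one b).
Proof.
have e1 : a^-1%g = (a^-1 * 1)%g by rewrite mulg1.
have e2 : 1%g = (c * c^-1)%g by rewrite mulgV.
have e3 : 1%g = (a * a^-1)%g by rewrite mulgV.
have e4 : a^-1%g = (1 * a^-1)%g by rewrite mul1g.
have e5 : 1%g = (a^-1 * a)%g by rewrite mulVg.
(* Summed over the fourfold coproduct of [x]. Contracting the first two factors gives the left side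
   of the lemma; contracting the last three gives the right side. *)
pose G u c1 c2 g := tens (anti a u * c1) c2 *t cop ec (anti c g).
transitivity (sweedler (cop e1 x) (fun u v =>
    sweedler (cop e3 v) (fun c1 w =>
      sweedler (cop e w) (fun c2 g => G u c1 c2 g)))).
  rewrite -(copA e5 e3 e4 e1 (g := fun u c1 w => sweedler (cop e w) (G u c1)));
    last by rewrite /G; multilin.
  transitivity (sweedler (cop e4 x) (fun v w => (eps v : k) *:
      sweedler (cop e w) (fun c2 g => tens (one a) c2 *t cop ec (anti c g)))).
    pose L (y : H a^-1%g) :=
      sweedler (cop e y) (fun c2 g => tens (one a) c2 *t cop ec (anti c g)).
    have lL : linop L by rewrite /L; multilin.
    rewrite -[in LHS](cop_counitl e4 x) -/(L _) (linop_sweedler_comm _ _ lL).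
    by apply: eq_sweedler => v w; rewrite (linopZ _ _ lL).
  apply: eq_sweedler => v w.
  pose L z := sweedler (cop e w) (fun c2 g => tens z c2 *t cop ec (anti c g)).
  have lL : linop L by rewrite /L; multilin.
  rewrite -/(L (one a)) -(linopZ _ _ lL) -(cop_antil e5).
  by rewrite (linop_sweedler_comm _ _ lL).
transitivity (sweedler (cop e1 x) (fun u v =>
    (eps v : k) *: tens (anti a u) (one b) : H a ⊗ H b)); last first.
  rewrite -[in RHS](cop_counitr e1 x).
  rewrite (@linop_sweedler_comm _ _ _ _ _ (fun y => tens (anti a y) (one b)));
    last by multilin.
  by apply: eq_sweedler => u v; rewrite linearZ linearZl_LR.
apply: eq_sweedler => u v; rewrite -(copA ec e e2 e3);
  last by rewrite /G; multilin.
pose L z := tens (anti a u) (one b) *t cop ec z.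
have lL : linop L by rewrite /L; multilin.
transitivity (L ((eps v : k) *: one c)).
  (* Multiplicativity merges the coproducts of [d] and of [anti c g] into that of [d * anti c g],
     where the antipode axiom applies. *)
  rewrite -(cop_antir e2 v) (linop_sweedler_comm _ _ lL).
  apply: eq_sweedler => d g; rewrite /L copM talg_mulA.
  pose L' t := tens (anti a u) (one b) *t t *t cop ec (anti c g).
  have lL' : linop L' by rewrite /L'; multilin.
  rewrite -/(L' _) [in RHS](sweedler_self (cop ec d)).
  rewrite (linop_sweedler_comm _ _ lL').
  by apply: eq_sweedler => c1 c2; rewrite /L' talg_mulE alg_mul1l.
by rewrite (linopZ _ _ lL) /L cop1 talg_mul1r.
Qed.

Variable lam : forall a : pi, {linear H a -> k^o}.
Hypothesis lamP : right_integral lam.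

Lemma integral_at a b c (e : c = (a * b)%g) (x : H c) :
  sweedler (cop e x) (fun y z => (lam a y : k) *: z) = (lam c x : k) *: one b.
Proof.
subst c; rewrite -lamP /cop /comul_at /=; set t := comul _ _ _ _.
have lU : linop (fun s => tunitl (tmap (lam a) idfun s) : H b).
  by move=> r s s'; rewrite !linearP.
rewrite [in RHS](sweedler_self t) (linop_sweedler_comm _ _ lU).
by apply: eq_sweedler => y z; rewrite tmap_tens tunitl_tens.
Qed.

(* This is what makes [(x, h) |-> lam (S x * h)] a coseparability form. *)
Lemma integral_anti a b c (ec : c = (a * b)%g) (e : a^-1%g = (b * c^-1)%g)
    (x : H a^-1%g) (h : H c) :
  sweedler (cop e x) (fun y g => (lam c (anti c g * h) : k) *: y) =
  sweedler (cop ec h) (fun h1 h2 => (lam a (anti a x * h1) : k) *: h2).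
Proof.
pose ev (t : H a ⊗ H b) := sweedler t (fun y z => (lam a y : k) *: z).
have lev : linop ev by rewrite /ev; multilin.
have evM y (t : H a ⊗ H b) : ev (tens (one a) y *t t) = y * ev t.
  pose L s := ev (tens (one a) y *t s); pose R s := y * ev s.
  have lL : linop L by move=> r s s'; rewrite /L linearPr lev.
  have lR : linop R by move=> r s s'; rewrite /R lev linearPr.
  rewrite -/(L t) -/(R t) [t]sweedler_self !linop_sweedler_comm //.
  apply: eq_sweedler => u v; rewrite /L /R talg_mulE alg_mul1l.
  by rewrite /ev !sweedler_tens ?linearZr_LR //=; multilin.
(* Apply [T] to both sides of [cop_anti]: on one side [copM] and the integral equation collapse the
   coproduct of [anti c g * h], on the other [ev] contracts directly. *)
pose T t := ev (t *t cop ec h).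
have lT : linop T by move=> r s s'; rewrite /T linearPl lev.
transitivity (T (tens (anti a x) (one b))).
  rewrite -(cop_anti ec e) (linop_sweedler_comm _ _ lT).
  apply: eq_sweedler => y g; rewrite /T -talg_mulA evM -copM.
  by rewrite /ev integral_at linearZr_LR /= alg_mul1r.
pose L s := ev (tens (anti a x) (one b) *t s).
have lL : linop L by move=> r s s'; rewrite /L linearPr lev.
rewrite /T -/(L _) (sweedler_self (cop ec h)) (linop_sweedler_comm _ _ lL).
rewrite -sweedler_self; apply: eq_sweedler => u v.
by rewrite /L talg_mulE alg_mul1l /ev sweedler_tens //; multilin.
Qed.

(** * Averaging a linear map over the integral *)

Section Averaging.
Variables (M : picomodule H) (f : {linear M 1%g -> M 1%g}).

Definition unit_r (a : pi) : a = (1 * a)%g := esym (mul1g a).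
Definition unit_l (a : pi) : 1%g = (a * a^-1)%g := esym (mulgV a).

(* In ungraded notation, [m |-> lam (S(f(m_0)_1) m_1) f(m_0)_0]. *)
Definition average a (m : M a) : M a :=
  sweedler (hcoact M (unit_r a) m) (fun u h =>
    sweedler (hcoact M (unit_l a) (f u)) (fun n g =>
      (lam a (anti a g * h) : k) *: n)).

Lemma linop_average a : linop (@average a).
Proof. by rewrite /average; multilin. Qed.

(** Coacting on the output of [average] splits [g] by coassociativity; [integral_anti] trades this
    for a splitting of [h], which coassociativity identifies with the coaction on [m]. *)
Lemma average_coact a b c (e : c = (a * b)%g) (m : M c) :
  hcoact M e (average m) =
  sweedler (hcoact M e m) (fun m' h => tens (average m') h).
Proof.
have e1 : a^-1%g = (b * c^-1)%g by rewrite e invgM mulVKg.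
rewrite /average linear_sweedler.
transitivity (sweedler (hcoact M (unit_r c) m) (fun u h =>
   sweedler (hcoact M (unit_l a) (f u)) (fun n g =>
     sweedler (cop e h) (fun h1 h2 =>
        tens ((lam a (anti a g * h1) : k) *: n) h2)))).
  apply: eq_sweedler => u h; rewrite linear_sweedler.
  transitivity (sweedler (hcoact M (unit_l c) (f u)) (fun n g =>
     sweedler (hcoact M e n) (fun n' y =>
        tens n' ((lam c (anti c g * h) : k) *: y)))).
    apply: eq_sweedler => n g.
    rewrite linearZ_LR [in LHS](sweedler_self (hcoact M e n)).
    rewrite (@linop_sweedler_comm _ _ _ _ _
      (fun t : M a ⊗ H b => (lam c (anti c g * h) : k) *: t)).
      by apply: eq_sweedler => n' y; rewrite linearZr_LR.
    by multilin.
  rewrite (hcoactA e e1 (unit_l c) (unit_l a)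
     (g := fun (n' : M a) (y : H b) (g : H c^-1%g) =>
       tens n' ((lam c (anti c g * h) : k) *: y))); last by multilin.
  apply: eq_sweedler => n g.
  transitivity (tens n (sweedler (cop e1 g) (fun y g =>
      (lam c (anti c g * h) : k) *: y))).
    rewrite (@linop_sweedler_comm _ _ _ _ _ (tens n)) //; by multilin.
  rewrite (integral_anti e) (@linop_sweedler_comm _ _ _ _ _ (tens n));
    last by multilin.
  by apply: eq_sweedler => h1 h2; rewrite linearZr_LR linearZl_LR.
transitivity (sweedler (hcoact M e m) (fun m' h2 =>
   sweedler (hcoact M (unit_r a) m') (fun u h1 =>
    sweedler (hcoact M (unit_l a) (f u)) (fun n g =>
       tens ((lam a (anti a g * h1) : k) *: n) h2)))).
  rewrite (hcoactA (unit_r a) e e (unit_r c)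
    (g := fun (u : M 1%g) (h1 : H a) (h2 : H b) =>
    sweedler (hcoact M (unit_l a) (f u)) (fun n g =>
       tens ((lam a (anti a g * h1) : k) *: n) h2))); last by multilin.
  by apply: eq_sweedler => u h; rewrite exchange_sweedler.
apply: eq_sweedler => m' h2.
rewrite (@linop_sweedler_comm _ _ _ _ _ (fun n : M a => tens n h2));
  last by multilin.
apply: eq_sweedler => u h1.
by rewrite (@linop_sweedler_comm _ _ _ _ _ (fun n : M a => tens n h2));
  last by multilin.
Qed.

(** Once [f] is dropped, coassociativity leaves the sum of [lam (S(m_1) m_2) m_0]; the antipode
    axiom and [lam1] reduce it to the counit identity. *)
Lemma average_id a (m : M a) : lam a (one a) = (1 : k) ->
  sweedler (hcoact M (unit_r a) m) (fun u h => tens (f u) h) =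
    hcoact M (unit_r a) m ->
  average m = m.
Proof.
move=> lam1 fm.
have e1 : 1%g = (a^-1 * a)%g by rewrite mulVg.
have e2 : a = (a * 1)%g by rewrite mulg1.
transitivity (sweedler (hcoact M (unit_r a) m) (fun u h =>
    sweedler (hcoact M (unit_l a) u) (fun n g =>
      (lam a (anti a g * h) : k) *: n))).
  pose L t := sweedler t (fun u h =>
    sweedler (hcoact M (unit_l a) u) (fun n g =>
      (lam a (anti a g * h) : k) *: n)).
  have lL : linop L by rewrite /L; multilin.
  rewrite -/(L _) -fm (linop_sweedler_comm _ _ lL).
  by apply: eq_sweedler => u h; rewrite /L sweedler_tens //; multilin.
rewrite (hcoactA (unit_l a) e1 (unit_r a) e2
  (g := fun (n : M a) (g : H a^-1%g) (h : H a) =>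
    (lam a (anti a g * h) : k) *: n)); last by multilin.
rewrite -[RHS](hcoact_counit e2).
apply: eq_sweedler => n v.
transitivity ((lam a (sweedler (cop e1 v) (fun g h => anti a g * h)) : k) *: n).
  rewrite linear_sweedler.
  rewrite (@linop_sweedler_comm _ _ _ _ _ (fun x : k^o => (x : k) *: n)) //.
  by multilin.
by rewrite cop_antil linearZ /= lam1 /GRing.scale /= mulr1.
Qed.
End Averaging.
End HopfSweedler.

(** * Integrals and cosemisimplicity *)

Section Support.
Variables (pi : groupType) (k : fieldType) (H : hopf_picoalgebra pi k).
Notation one a := (alg_one (H a)).

Lemma one_eq0 a : one a = 0 -> forall h : H a, h = 0.
Proof. by move=> one0 h; rewrite -[h]alg_mul1l one0 linear0l. Qed.

Lemma one1_neq0 : one 1%g <> 0.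
Proof.
move=> one0; have := eps1 H; rewrite one0 linear0 => /esym/eqP.
by rewrite oner_eq0.
Qed.

(** The coproduct of the unit is the tensor of two nonzero units. *)
Lemma one_mul_neq0 a b : one a <> 0 -> one b <> 0 -> one (a * b)%g <> 0.
Proof.
move=> a0 b0 ab0; have := cop1 H (erefl (a * b)%g).
by rewrite ab0 linear0 => /esym/tens_eq0[].
Qed.

(** The antipode axiom at the unit of degree 1 writes [one a] as a product with a factor coming from
    [one a^-1]. *)
Lemma one_inv_neq0 a : one a <> 0 -> one a^-1%g <> 0.
Proof.
move=> a0 aV0; apply: a0.
have e : 1%g = (a^-1 * a)%g by rewrite mulVg.
have := cop_antil e (one 1%g); rewrite eps1 scale1r => <-.
by rewrite cop1 aV0 sweedler_tens ?linear0 ?linear0l //; multilin.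
Qed.

(** For [b = a (a^-1 b)] the integral equation at [one b] compares two multiples of the unit of
    degree [a^-1 b], which is nonzero. *)
Lemma integral_one lam : @right_integral pi k H lam ->
  (exists a, lam a (one a) = (1 : k)) ->
  forall a, one a <> 0 -> lam a (one a) = (1 : k).
Proof.
move=> lamP [a lam1] b b0.
have a0 : one a <> 0.
  by move=> a0; move: lam1; rewrite a0 linear0 => /esym/eqP; rewrite oner_eq0.
have e : b = (a * (a^-1 * b))%g by rewrite mulVKg.
have c0 := one_mul_neq0 (one_inv_neq0 a0) b0.
have := integral_at lamP e (one b); rewrite cop1 sweedler_tens; last by multilin.
rewrite lam1 => /eqP; rewrite -subr_eq0 -scalerBl scaler_eq0 => /orP[|/eqP//].
by rewrite subr_eq0 => /eqP.
Qed.

Lemma is_sub_one : is_sub (M := regular_comodule H)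
  (fun a => [set u : H a | exists c : k, u = c *: one a]).
Proof.
split=> [a|a b _ [c ->]]; first exact: subspace_line.
rewrite linearZ_LR; apply: subspaceZ.
  by apply: subspace_tensor_subl; exact: subspace_line.
rewrite [coact _ _ _ _](cop1 H (erefl (a * b)%g)).
by apply: tensor_subl_tens; exists 1; rewrite scale1r.
Qed.

Lemma sub_coact_at (C : picoalgebra pi k) (M : picomodule C) N a b c
    (e : c = (a * b)%g) (x : M c) :
  is_sub N -> N c x -> tensor_subl (N a) (coact_at M e x).
Proof. by move=> [_ NC]; subst c; exact: NC. Qed.

Lemma cosemisimple_integral : cosemisimple H ->
  exists2 lam, @right_integral pi k H lam & exists a, lam a (one a) = (1 : k).
Proof.
move=> cH.
have one1 : (fun a => [set u : H a | exists c : k, u = c *: one a]) 1%g (one 1%g).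
  by exists 1; rewrite scale1r.
have [N [sN nN1 span]] := exists_supplement cH is_sub_one one1 one1_neq0.
(* The coaction from degree [a] to degrees [1] and [a] would put [one 1 (x) one a] in [N 1 (x) H a],
   and contracting with [phi] would put [one 1] in [N 1]. *)
have nN a : one a <> 0 -> ~ N a (one a).
  move=> a0 N1; apply: nN1.
  have [phi phi1 _] := separating_functional (subspace_zero (H a)) a0.
  have := sub_coact_at (unit_r a) sN N1.
  rewrite [coact_at _ _ _](cop1 H (unit_r a)).
  move/(linear_tensor_subl (L := fun t => tunitr (tmap idfun phi t)) _ (sN.1 1%g)).
  rewrite tmap_tens tunitr_tens phi1 scale1r; apply; first by multilin.
  move=> v w Nv; rewrite tmap_tens tunitr_tens.
  exact: subspaceZ (sN.1 1%g) _ _ Nv.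
have lamE a : exists phi : {linear H a -> k^o},
    (one a <> 0 -> phi (one a) = 1) /\ forall n, N a n -> phi n = 0.
  have [a0|a0] := pselect (one a = 0).
    by exists \0.
  have [phi phi1 phiN] := separating_functional (sN.1 a) (nN a a0).
  by exists phi.
pose lam a := sval (cid (lamE a)).
have lam1 a : one a <> 0 -> lam a (one a) = 1 := (svalP (cid (lamE a))).1.
have lamN a n : N a n -> lam a n = 0 := (svalP (cid (lamE a))).2 n.
exists lam; last by exists 1%g; apply: lam1; exact: one1_neq0.
(* Both sides of the integral equation vanish on [N], so only multiples of the unit remain. *)
move=> a b x; have [n Nn [_ [c ->] ->]] := span _ x.
rewrite !linearD /= (lamN _ _ Nn) !linearZ_LR /= addrC scalerDl.
rewrite scale0r add0r (_ : tunitl (tmap _ _ (comul H a b n)) = 0) ?addr0; last first.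
  apply: (linear_tensor_subl (Y := [set 0])
    (L := fun t => tunitl (tmap (lam a) idfun t))) (sN.2 _ _ _ Nn);
    [by multilin|exact: subspace_zero|move=> v w Nv].
  by rewrite tmap_tens tunitl_tens /= (lamN _ _ Nv) scale0r.
rewrite [comul _ _ _ _](cop1 H (erefl (a * b)%g)) tmap_tens tunitl_tens /=.
have [->|b0] := pselect (one b = 0); first by rewrite !scaler0.
rewrite -scalerA; congr (_ *: (_ *: _)).
(* As [one b] is nonzero, [one a] and [one (a * b)] vanish together, since [a = (a * b) * b^-1]. *)
have [a0|a0] := pselect (one a = 0); last by rewrite !lam1 //; exact: one_mul_neq0.
have -> : one (a * b)%g = 0.
  apply: contrapT => ab0; have := one_mul_neq0 ab0 (one_inv_neq0 b0).
  by rewrite mulgK a0.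
by rewrite a0 !linear0.
Qed.

Lemma integral_cosemisimple lam (M : picomodule H) :
  @right_integral pi k H lam ->
  (forall a, one a <> 0 -> lam a (one a) = (1 : k)) -> reduced M ->
  cosemisimple_comodule M.
Proof.
move=> lamP lam1 redM; apply: complemented_cosemisimple => N sN.
have [|f [Nf fid _]] := linear_projection (sN.1 1%g) (subspace_zero _).
  by move=> v _ ->.
exists (fun a => linop_map (@linop_average _ _ H lam M f a)); last first.
  move=> a b x; rewrite /linop_map /=.
  have := average_coact lamP f (erefl (a * b)%g) x.
  rewrite /hcoact /coact_at /= => ->.
  rewrite {1}[coact M a b x]sweedler_self linear_sweedler.
  by apply: eq_sweedler => m h; exact: tmap_tens.
move=> a x; rewrite /linop_map /=; split=> [|Nx].
  apply: subspace_sweedler (sN.1 a) _ => u h.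
  (* The average stays in [N] because [f u] lies in [N 1], whose coaction lands in
     [N a (x) H a^-1]. *)
  pose L t := sweedler t (fun (n : M a) (g : H a^-1%g) =>
    (lam a (alg_mul (H a) (anti H a g) h) : k) *: n).
  apply: (linear_tensor_subl (L := L)) (sub_coact_at (unit_l a) sN (Nf u)).
  - by rewrite /L; multilin.
  - exact: sN.1.
  move=> n g Nn; rewrite /L sweedler_tens; last by multilin.
  exact: subspaceZ (sN.1 a) _ _ Nn.
(* Where the unit vanishes no normalisation is available, but reducedness makes [M a] zero. *)
have [a0|a0] := pselect (one a = 0).
  have M0 := redM a (one_eq0 a0).
  by rewrite [LHS]M0 [RHS]M0.
apply: average_id => //; first exact: lam1.
rewrite [RHS]sweedler_self.
apply: (eq_tensor_subl (L := fun t => sweedler t (fun u h => tens (f u) h))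
  (L' := fun t => sweedler t (fun u h => tens u h))) (sub_coact_at (unit_r a) sN Nx).
- by multilin.
- by multilin.
move=> v w Nv; rewrite !sweedler_tens; [|by multilin|by multilin].
by rewrite fid.
Qed.

End Support.

Theorem theorem5 (pi : groupType) (k : fieldType) (H : hopf_picoalgebra pi k) :
  [<-> (* (a) *)
       forall M : picomodule H, reduced M -> cosemisimple_comodule M;
       (* (b) *)
       cosemisimple H;
       (* (c) *)
       exists2 lam : forall a : pi, {linear H a -> k^o},
         right_integral lam & exists a : pi, lam a (alg_one (H a)) = (1 : k);
       (* (d) *)
       exists2 lam : forall a : pi, {linear H a -> k^o},
         right_integral lam &
         forall a : pi, ~ (forall h : H a, h = 0) -> lam a (alg_one (H a)) = (1 : k)].
Proof.
tfae.
- by apply; move=> a H0 m; exact: H0.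
- exact: cosemisimple_integral.
- move=> [lam lamP lam1]; exists lam => // a Ha; apply: integral_one => // a0.
  by apply: Ha; exact: one_eq0.
- move=> [lam lamP lam1] M redM.
  apply: (integral_cosemisimple lamP) redM => a a0.
  by apply: lam1 => H0; exact: a0.
Qed.
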